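(* Let $\mathbb{K}=(G,M,I,\preceq)$ be an extended formal context, and consider the minimised-return operator $B\mapsto(\underline{B'})'$ on subsets $B\subseteq M$. Then: (i) (non-monotonicity) the operator is not monotone in general: there exist an extended formal context $(G,M,I,\preceq)$ and sets $A\subseteq B\subseteq M$ with $(\underline{A'})'\not\subseteq(\underline{B'})'$; (ii) (extensivity) for every $A\subseteq M$, $A\subseteq(\underline{A'})'$; (iii) (idempotence) for every $A\subseteq M$, $\big(\underline{((\underline{A'})')'}\big)'=(\underline{A'})'$.
   Context: A formal context is a triple $(G,M,I)$ with $G$ a finite non-empty set of objects, $M$ a finite non-empty set of attributes, and $I\subseteq G\times M$. An extended formal context is a quadruple $(G,M,I,\preceq)$ where $(G,M,I)$ is a formal context and $\preceq$ is a partial order on $G$ (read $g\preceq h$ as ''$g$ is more preferred/typical than $h$''); $\prec$ denotes its strict part. Derivation operators: for $A\subseteq G$, $A'=\{m\in M\mid \forall g\in A,\ (g,m)\in I\}$; for $B\subseteq M$, $B'=\{g\in G\mid \forall m\in B,\ (g,m)\in I\}$. The minimised derivation of $B\subseteq M$ is $\underline{B'}=\{g\in B'\mid \nexists h\in B' \text{ with } h\prec g\}$, and the minimised-return operator sends $B$ to $(\underline{B'})'\subseteq M$. *)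

(* Defs.v *)
From mathcomp Require Import all_boot.

Set Implicit Arguments.
Unset Strict Implicit.
Unset Printing Implicit Defensive.

Record formal_context := FormalContext {
  obj : finType;
  attr : finType;
  incidence : {set obj * attr};
  obj_nonempty : 0 < #|obj|;
  attr_nonempty : 0 < #|attr|
}.

(* [pref g h]: g is more preferred (more typical) than, or equal to, h. *)
Record ext_context := ExtContext {
  base_context :> formal_context;
  pref : rel (obj base_context);
  pref_refl : reflexive pref;
  pref_anti : antisymmetric pref;
  pref_trans : transitive pref
}.

Definition obj_deriv (K : formal_context) (A : {set obj K}) : {set attr K} :=
  [set m | [forall g in A, (g, m) \in incidence K]].

Definition attr_deriv (K : formal_context) (B : {set attr K}) : {set obj K} :=
  [set g | [forall m in B, (g, m) \in incidence K]].

Definition spref (K : ext_context) : rel (obj K) :=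
  fun g h => (g != h) && pref g h.

Definition min_deriv (K : ext_context) (B : {set attr K}) : {set obj K} :=
  [set g in attr_deriv B | ~~ [exists h in attr_deriv B, spref h g]].

Definition min_return (K : ext_context) (B : {set attr K}) : {set attr K} :=
  obj_deriv (min_deriv B).

(* Main.v *)
(** Idempotence is already visible on the object side: writing [C] for the
    minimised return of [A], one has [min A' \subset C' \subset A'].  Since the
    object set is finite, every element of [A'] lies above an element of
    [min A'], so [C'] and [A'] have the same minimal elements. *)

Require Import Defs.
From mathcomp Require Import all_boot.

Set Implicit Arguments.
Unset Strict Implicit.
Unset Printing Implicit Defensive.

Lemma obj_derivP (K : formal_context) (A : {set obj K}) (m : attr K) :
  reflect (forall g, g \in A -> (g, m) \in incidence K) (m \in obj_deriv A).
Proof. by rewrite inE; apply: forall_inP. Qed.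

Lemma attr_derivP (K : formal_context) (B : {set attr K}) (g : obj K) :
  reflect (forall m, m \in B -> (g, m) \in incidence K) (g \in attr_deriv B).
Proof. by rewrite inE; apply: forall_inP. Qed.

Lemma attr_derivS (K : formal_context) (A B : {set attr K}) :
  A \subset B -> attr_deriv B \subset attr_deriv A.
Proof.
move=> sAB; apply/subsetP => g /attr_derivP gB; apply/attr_derivP => m mA.
exact/gB/(subsetP sAB).
Qed.

Lemma sub_attr_obj_deriv (K : formal_context) (A : {set obj K}) :
  A \subset attr_deriv (obj_deriv A).
Proof.
by apply/subsetP => g gA; apply/attr_derivP => m /obj_derivP; apply.
Qed.

Section MinReturn.
Variable K : ext_context.
Implicit Types (A B : {set attr K}) (g h : obj K).

Lemma min_derivP B g :
  reflect (g \in attr_deriv B /\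
           forall h, h \in attr_deriv B -> pref h g -> h = g)
          (g \in min_deriv B).
Proof.
rewrite [g \in min_deriv B]inE; apply: (iffP andP) => -[gB ming]; split=> //.
  move=> h hB le_hg; apply/eqP/negPn/negP => neq_hg; case/negP: ming.
  by apply/exists_inP; exists h => //; rewrite /spref neq_hg.
by apply/exists_inP => -[h hB /andP[/eqP neq_hg le_hg]]; apply/neq_hg/ming.
Qed.

Lemma min_deriv_sub B : min_deriv B \subset attr_deriv B.
Proof. by apply/subsetP => g /min_derivP[]. Qed.

(** Finiteness enters here: among the elements of [attr_deriv B] below [g], one whose down-set has
    the fewest elements is minimal. *)
Lemma min_deriv_below B g :
  g \in attr_deriv B -> exists2 h, h \in min_deriv B & pref h g.
Proof.
move=> gB; pose P := [pred h | (h \in attr_deriv B) && pref h g].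
have Pg : P g by rewrite /= gB pref_refl.
have [h /andP[hB le_hg] minh] :=
  arg_minnP (fun h : obj K => #|[set k | pref k h]|) Pg.
exists h => //; apply/min_derivP; split=> // k kB le_kh.
have le_kg := pref_trans le_kh le_hg.
apply: pref_anti; rewrite le_kh /=.
(* By transitivity the down-set of [k] lies in that of [h]; the choice of [h] makes the two equal,
   so [h] lies below [k], and antisymmetry gives [k = h]. *)
have sub_kh : [set l | pref l k] \subset [set l | pref l h].
  by apply/subsetP => l; rewrite !inE => /pref_trans; apply.
have /eqP eq_kh : [set l | pref l k] == [set l | pref l h].
  by rewrite eqEcard sub_kh minh //= kB.
by move/setP/(_ h): eq_kh; rewrite !inE pref_refl.
Qed.

Lemma sub_min_return A : A \subset min_return A.
Proof.
apply/subsetP => m mA; apply/obj_derivP => g /(subsetP (min_deriv_sub A)).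
by move/attr_derivP; apply.
Qed.

Lemma min_deriv_return A : min_deriv (min_return A) = min_deriv A.
Proof.
have sCA := subsetP (attr_derivS (sub_min_return A)).
have sAC := subsetP (sub_attr_obj_deriv (min_deriv A)).
apply/setP => g; apply/idP/idP => [/min_derivP[gC ming]|gA].
  (* The minimal [h] found below [g] also lies in [attr_deriv (min_return A)], where [g] is minimal;
     hence [h = g]. *)
  have [h hA le_hg] := min_deriv_below (sCA _ gC).
  by rewrite -(ming _ (sAC _ hA) le_hg).
have [_ ming] := min_derivP _ _ gA.
by apply/min_derivP; split=> [|h /sCA]; [apply: sAC | apply: ming].
Qed.

Lemma min_return_idem A : min_return (min_return A) = min_return A.
Proof. by rewrite {1}/min_return min_deriv_return. Qed.

End MinReturn.

Lemma card_bool_gt0 : 0 < #|{: bool}|.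
Proof. by rewrite card_bool. Qed.

(** On the diagonal each object has only itself as attribute, so requiring the attribute [false]
    excludes the preferred object [true]. *)
Definition diag_context : formal_context :=
  @FormalContext bool bool [set p | p.1 == p.2] card_bool_gt0 card_bool_gt0.

(* [true] is strictly preferred to [false]. *)
Definition diag_pref : rel (obj diag_context) := fun g h : bool => h ==> g.

Lemma diag_pref_refl : reflexive diag_pref.
Proof. by case. Qed.

Lemma diag_pref_anti : antisymmetric diag_pref.
Proof. by case; case. Qed.

Lemma diag_pref_trans : transitive diag_pref.
Proof. by case; case; case. Qed.

Definition diag_ext_context : ext_context :=
  ExtContext diag_pref_refl diag_pref_anti diag_pref_trans.

(** With no attribute required, [true] is the only minimal object, so the return of [set0] is the
    singleton of [true]. Requiring [false] leaves only the object [false], which lacks the attribute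
    [true]. *)
Lemma min_return_not_monotone :
  exists (K : ext_context) (A B : {set attr K}),
    A \subset B /\ ~~ (min_return A \subset min_return B).
Proof.
exists diag_ext_context, set0, [set false : attr diag_ext_context].
split; first exact: sub0set.
apply/subsetPn; exists (true : attr diag_ext_context).
  apply/obj_derivP => g /min_derivP[_ ming].
  rewrite inE /= -(ming true) //; last by case: (g).
  by apply/attr_derivP => m; rewrite inE.
apply/negP => /obj_derivP/(_ false) incFT.
(* Once [false] is known to be minimal, [incFT] would put the off-diagonal pair [(false, true)] in
   the incidence. *)
suff /incFT : (false : obj diag_ext_context)
    \in min_deriv [set false : attr diag_ext_context] by rewrite inE.
apply/min_derivP; split=> [|h].
  by apply/attr_derivP => m /set1P ->; rewrite inE.
by move/attr_derivP/(_ false (set11 _)); rewrite inE => /eqP.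
Qed.

Theorem theorem1 :
  (exists (K : ext_context) (A B : {set attr K}),
      A \subset B /\ ~~ (min_return A \subset min_return B)) /\
  (forall (K : ext_context) (A : {set attr K}), A \subset min_return A) /\
  (forall (K : ext_context) (A : {set attr K}),
      min_return (min_return A) = min_return A).
Proof.
split; first exact: min_return_not_monotone.
by split; [exact: sub_min_return | exact: min_return_idem].
Qed.
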